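(* Let $V=(v_1,\dots,v_n)$ be a positively spanning configuration of $n$ different unit vectors in $\mathbb{R}^d$ with Gale dual $\bar V=(\bar v_1,\dots,\bar v_n)$ in $\mathbb{R}^{n-d}\cong\mathbb{R}^n/\operatorname{im}V$. Let $\Delta$ be a complete pointed fan with rays generated by $V$. Then the type cone $T(\Delta)$ is a relatively open chamber in the chamber fan $\operatorname{Ch}(\bar V)$.
   Context: $V$ also denotes the $n\times d$ matrix with rows $v_i$, and $\pi:\mathbb{R}^n\to\mathbb{R}^n/\operatorname{im}V\cong\mathbb{R}^{n-d}$ is the projection, after a fixed choice of linear isomorphism. The Gale dual is the configuration of the vectors $\bar v_i=\pi(e_i)$, where $e_i$ is the $i$-th standard basis vector of $\mathbb{R}^n$. A fan is a collection of convex polyhedral cones closed under taking faces, any two of which intersect in a common face; complete means that the union of the cones is $\mathbb{R}^d$, pointed means that no cone contains a nonzero linear subspace. The normal fan of a convex polyhedron $P\subset\mathbb{R}^d$ consists of the cones $N_F(P)=\{v\in\mathbb{R}^d:\max_{x\in P}\langle v,x\rangle=\langle v,p\rangle\ \forall p\in F\}$ over nonempty faces $F$ of $P$. The type cone $T(\Delta)$ is the set of all convex polyhedra with normal fan $\Delta$ modulo translation; with $P(h)=\{x\in\mathbb{R}^d:Vx\le h\}$ it is identified with the set $\{\pi(h): h\in\mathbb{R}^n$ the support vector of a polyhedron $P(h)$ with normal fan $\Delta\}\subset\mathbb{R}^n/\operatorname{im}V$. For a vector configuration $W=(w_1,\dots,w_n)$ in $\mathbb{R}^m$, two vectors $y_1,y_2$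 are said to lie in the same relatively open chamber if for every $I\subset\{1,\dots,n\}$ one has $y_1\in\operatorname{pos}(W_I)\Leftrightarrow y_2\in\operatorname{pos}(W_I)$, where $W_I=(w_i)_{i\in I}$ and $\operatorname{pos}$ is the positive hull (the set of non-negative linear combinations). The closure of a relatively open chamber is called a chamber, and the collection of all chambers is the chamber fan $\operatorname{Ch}(W)$.
   Formalization: The formal theorem additionally assumes that some convex polyhedron has normal fan Δ (T(Δ) is nonempty); for non-polytopal complete pointed fans, which exist in R^3, T(Δ) is empty and so is not a relatively open chamber. *)

(* Defs.v *)
From HB Require Import structures.
From mathcomp Require Import all_boot all_order all_algebra.
From mathcomp Require Import all_classical all_reals all_analysis.

Set Implicit Arguments.
Unset Strict Implicit.
Unset Printing Implicit Defensive.

Import Order.TTheory GRing.Theory Num.Theory.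
Import numFieldNormedType.Exports.

Local Open Scope classical_set_scope.
Local Open Scope ring_scope.

(* Points of R^d are column vectors; a configuration of n vectors in R^d is
   the n x d matrix V whose rows are the vectors. *)

Definition dot (R : realType) (d : nat) (u v : 'cV[R]_d) : R :=
  \sum_(k < d) u k 0 * v k 0.

Definition enorm (R : realType) (d : nat) (v : 'cV[R]_d) : R :=
  Num.sqrt (dot v v).

Definition cvec (R : realType) (n d : nat) (V : 'M[R]_(n, d)) (i : 'I_n) :
  'cV[R]_d := (row i V)^T.

(* The positive hull of (W_i)_{i in I}; it is {0} when I is empty. *)
Definition pos (R : realType) (n m : nat) (W : 'I_n -> 'cV[R]_m)
    (I : {set 'I_n}) : set 'cV[R]_m :=
  [set y | exists c : 'I_n -> R,
     (forall i, 0 <= c i) /\ y = \sum_(i in I) c i *: W i].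

Definition pos_all (R : realType) (n m : nat) (W : 'I_n -> 'cV[R]_m) :
  set 'cV[R]_m := pos W (finset.setT : {set 'I_n}).

Definition halfline (R : realType) (d : nat) (v : 'cV[R]_d) : set 'cV[R]_d :=
  pos_all (fun _ : 'I_1 => v).

Definition positively_spanning (R : realType) (n d : nat) (V : 'M[R]_(n, d)) :
  Prop := pos_all (cvec V) = setT.

Definition polyhedron (R : realType) (m d : nat) (A : 'M[R]_(m, d))
    (b : 'cV[R]_m) : set 'cV[R]_d :=
  [set x | forall i, (A *m x) i 0 <= b i 0].

Definition convex_polyhedron (R : realType) (d : nat) (P : set 'cV[R]_d) :
  Prop :=
  exists (m : nat) (A : 'M[R]_(m, d)) (b : 'cV[R]_m), P = polyhedron A b.

Definition polyhedral_cone (R : realType) (d : nat) (C : set 'cV[R]_d) : Prop :=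
  exists (k : nat) (W : 'I_k -> 'cV[R]_d), C = pos_all W.

(* Nonempty faces only; a = 0, b = 0 gives P itself. *)
Definition face (R : realType) (d : nat) (P F : set 'cV[R]_d) : Prop :=
  F !=set0 /\
  exists (a : 'cV[R]_d) (b : R),
    (forall x, P x -> dot a x <= b) /\ F = P `&` [set x | dot a x = b].

Definition is_fan (R : realType) (d : nat) (Delta : set (set 'cV[R]_d)) :
  Prop :=
  [/\ forall C, Delta C -> polyhedral_cone C,
      forall C F, Delta C -> face C F -> Delta F &
      forall C1 C2, Delta C1 -> Delta C2 ->
        face C1 (C1 `&` C2) /\ face C2 (C1 `&` C2)].

Definition complete_fan (R : realType) (d : nat)
    (Delta : set (set 'cV[R]_d)) : Prop :=
  \bigcup_(C in Delta) C = setT.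

Definition pointed_fan (R : realType) (d : nat)
    (Delta : set (set 'cV[R]_d)) : Prop :=
  forall (C : set 'cV[R]_d) (U : {vspace 'cV[R]_d}), Delta C ->
    (forall x, x \in U -> C x) -> U = 0%VS.

Definition rays (R : realType) (d : nat) (Delta : set (set 'cV[R]_d)) :
  set (set 'cV[R]_d) :=
  [set C | Delta C /\ exists v : 'cV[R]_d, v != 0 /\ C = halfline v].

Definition normal_cone (R : realType) (d : nat) (P F : set 'cV[R]_d) :
  set 'cV[R]_d :=
  [set v | forall p, F p -> P p /\ forall x, P x -> dot v x <= dot v p].

Definition normal_fan (R : realType) (d : nat) (P : set 'cV[R]_d) :
  set (set 'cV[R]_d) :=
  [set normal_cone P F | F in face P].

Definition has_normal_fan (R : realType) (d : nat)
    (Delta : set (set 'cV[R]_d)) (P : set 'cV[R]_d) : Prop :=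
  convex_polyhedron P /\ normal_fan P = Delta.

(* h_i = max_{x in P} <v_i, x> for every i, the maximum being attained. *)
Definition support_vector (R : realType) (n d : nat) (V : 'M[R]_(n, d))
    (P : set 'cV[R]_d) (h : 'cV[R]_n) : Prop :=
  forall i, (forall x, P x -> dot (cvec V i) x <= h i 0) /\
            (exists2 x, P x & dot (cvec V i) x = h i 0).

(* A linear surjection R^n -> R^(n-d) with kernel im V is the same thing as the
   quotient map R^n -> R^n / im V followed by a linear isomorphism.  The
   subtraction is harmless: a positively spanning V has d <= n. *)
Definition quotient_projection (R : realType) (n d : nat) (V : 'M[R]_(n, d))
    (pi : {linear 'cV[R]_n -> 'cV[R]_(n - d)}) : Prop :=
  (forall y, exists h, pi h = y) /\
  (forall h, pi h = 0 <-> exists x : 'cV[R]_d, h = V *m x).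

Definition gale_dual (R : realType) (n m : nat)
    (pi : {linear 'cV[R]_n -> 'cV[R]_m}) (i : 'I_n) : 'cV[R]_m :=
  pi (delta_mx i 0).

(* The type cone, seen in R^n / im V through support vectors. *)
Definition type_cone (R : realType) (n d : nat) (V : 'M[R]_(n, d))
    (pi : {linear 'cV[R]_n -> 'cV[R]_(n - d)})
    (Delta : set (set 'cV[R]_d)) : set 'cV[R]_(n - d) :=
  [set y | exists h : 'cV[R]_n,
     [/\ has_normal_fan Delta (polyhedron V h),
         support_vector V (polyhedron V h) h & y = pi h]].

Definition same_open_chamber (R : realType) (n m : nat)
    (W : 'I_n -> 'cV[R]_m) (y1 y2 : 'cV[R]_m) : Prop :=
  forall I : {set 'I_n}, pos W I y1 <-> pos W I y2.

Definition rel_open_chamber (R : realType) (n m : nat)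
    (W : 'I_n -> 'cV[R]_m) (S : set 'cV[R]_m) : Prop :=
  exists y, S = [set y' | same_open_chamber W y y'].

Definition chamber_fan (R : realType) (n m : nat) (W : 'I_n -> 'cV[R]_m) :
  set (set 'cV[R]_m) :=
  [set closure S | S in rel_open_chamber W].

(* Main.v *)
Require Import Defs.
From HB Require Import structures.
From mathcomp Require Import all_boot all_order all_algebra.
From mathcomp Require Import all_classical all_reals all_analysis.
From mathcomp Require Import ring lra.

Set Implicit Arguments.
Unset Strict Implicit.
Unset Printing Implicit Defensive.

Import Order.TTheory GRing.Theory Num.Theory.
Import numFieldNormedType.Exports.

Local Open Scope classical_set_scope.
Local Open Scope ring_scope.

(* For h in R^n, pi(h) lies in pos of the Gale dual vectors indexed by I exactly
   when some x in P(h) satisfies <v_j, x> = h_j for all j outside I.  Hence the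
   relatively open chamber of pi(h) records which sets of inequalities of P(h)
   can be simultaneously tight.  If h is the support vector of P(h), these are
   the sets of v_j contained in a common normal cone, so the normal fan
   determines the chamber.  Conversely, since the v_i span positively, these
   sets determine the sets of inequalities that are exactly the tight ones at
   some point of P(h); the cones they span are the normal cones of P(h). *)

(** * Inner product and Farkas' lemma *)

Section Dot.
Variables (R : realType) (d : nat).
Implicit Types (u v w : 'cV[R]_d) (a : R).

Lemma dotC u v : dot u v = dot v u.
Proof. by apply: eq_bigr => k _; rewrite mulrC. Qed.

Lemma dotDr u v w : dot u (v + w) = dot u v + dot u w.
Proof. by rewrite -big_split /=; apply: eq_bigr => k _; rewrite mxE mulrDr. Qed.

Lemma dotZr a u v : dot u (a *: v) = a * dot u v.
Proof. by rewrite mulr_sumr; apply: eq_bigr => k _; rewrite mxE mulrCA. Qed.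

Lemma dotNr u v : dot u (- v) = - dot u v.
Proof. by rewrite -scaleN1r dotZr mulN1r. Qed.

Lemma dotBr u v w : dot u (v - w) = dot u v - dot u w.
Proof. by rewrite dotDr dotNr. Qed.

Lemma dotDl u v w : dot (u + v) w = dot u w + dot v w.
Proof. by rewrite !(dotC _ w) dotDr. Qed.

Lemma dotZl a u v : dot (a *: u) v = a * dot u v.
Proof. by rewrite !(dotC _ v) dotZr. Qed.

Lemma dotNl u v : dot (- u) v = - dot u v.
Proof. by rewrite !(dotC _ v) dotNr. Qed.

Lemma dotBl u v w : dot (u - v) w = dot u w - dot v w.
Proof. by rewrite dotDl dotNl. Qed.

Lemma dot0r u : dot u 0 = 0.
Proof. by rewrite -(scale0r 0) dotZr mul0r. Qed.

Lemma dot_sumr (I : finType) (A : {pred I}) (F : I -> 'cV[R]_d) u :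
  dot u (\sum_(i in A) F i) = \sum_(i in A) dot u (F i).
Proof. by elim/big_ind2: _ => [|v1 a1 v2 a2 <- <-|//]; rewrite ?dot0r ?dotDr. Qed.

Lemma dot_suml (I : finType) (A : {pred I}) (F : I -> 'cV[R]_d) u :
  dot (\sum_(i in A) F i) u = \sum_(i in A) dot (F i) u.
Proof. by rewrite dotC dot_sumr; apply: eq_bigr => i _; rewrite dotC. Qed.

Lemma dot_gt0 u : u != 0 -> 0 < dot u u.
Proof.
move=> u0; rewrite lt_neqAle sumr_ge0 ?andbT => [|k _]; last first.
  by rewrite -expr2 sqr_ge0.
apply: contra_neq u0 => /esym/eqP.
rewrite psumr_eq0 => [/allP u0|k _]; last by rewrite -expr2 sqr_ge0.
apply/matrixP => i j; rewrite !mxE (ord1 j).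
by have := u0 i (mem_index_enum _); rewrite mulf_eq0 orbb => /eqP.
Qed.

End Dot.

(* Induction on the number of generators [Bartl]: if dropping the generator
   [W k] breaks the hypothesis at [x], shear along [W k] so that [x] becomes
   orthogonal to all the remaining data. *)
Lemma farkas (R : realType) (n d : nat) (W : 'I_n -> 'cV[R]_d)
    (I : {set 'I_n}) (v : 'cV[R]_d) :
  (forall u, (forall i, i \in I -> dot (W i) u <= 0) -> dot v u <= 0) ->
  pos W I v.
Proof.
have [m] := ubnP #|I|; elim: m => // m IHm in I W v *.
have [->|[k kI]] := finset.set_0Vmem I => cardI vW.
  exists (fun=> 0); split=> //; rewrite big_set0.
  apply/eqP; apply: contraT => /dot_gt0.
  by rewrite ltNge vW // => i; rewrite inE.
have cardIk : (#|I :\ k| < m)%N by rewrite (cardsD1 k) kI in cardI.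
have [vWk|/existsNP[x /not_implyP[xW /negP]]] := pselect (forall u,
    (forall i, i \in I :\ k -> dot (W i) u <= 0) -> dot v u <= 0).
  have [c [c0 ->]] := IHm _ _ _ cardIk vWk.
  exists (fun i => if i == k then 0 else c i); split=> [i|]; first by case: eqP.
  rewrite [RHS](big_setD1 k) //= eqxx scale0r add0r.
  by apply: eq_bigr => i; rewrite !inE => /andP[/negPf->].
rewrite -ltNge => vx0.
have kx0 : 0 < dot (W k) x.
  rewrite ltNge; apply/negP => kx; suff: dot v x <= 0 by rewrite leNgt vx0.
  apply: vW => i iI; have [->//|ik] := eqVneq i k.
  by apply: xW; rewrite !inE ik.
pose s u := dot u x / dot (W k) x.
have [|c [c0 vE]] := IHm _ (fun i => W i - s (W i) *: W k) (v - s v *: W k) cardIk.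
  (* The correction along [x] is adjoint to the shear of the generators. It makes [u'] orthogonal to
     [W k], so the generator left out of the induction satisfies its constraint with equality. *)
  move=> u uW; pose u' := u - (dot (W k) u / dot (W k) x) *: x.
  have shear w : dot (w - s w *: W k) u = dot w u'.
    by rewrite /u' /s dotBl dotBr dotZl dotZr; field; rewrite gt_eqF.
  rewrite shear; apply: vW => i iI; have [->|ik] := eqVneq i k.
    by rewrite /u' dotBr dotZr divfK ?subrr ?gt_eqF.
  by rewrite -shear uW // !inE ik.
have sle0 i : i \in I :\ k -> s (W i) <= 0.
  by move=> /xW Wix; rewrite pmulr_lle0 ?invr_gt0.
(* The coefficient of [W k] once the shear is undone. It is nonnegative because [s v] is positive
   and every [s (W j)] is at most 0. *)
pose ck := s v - \sum_(j in I :\ k) c j * s (W j).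
exists (fun i => if i == k then ck else c i); split=> [i|].
  case: eqP => // _; rewrite /ck subr_ge0 (@le_trans _ _ 0) //; last first.
    by rewrite divr_ge0 // ltW.
  by apply: sumr_le0 => j /sle0 ?; rewrite mulr_ge0_le0.
rewrite (big_setD1 k) //= eqxx /ck scalerBl -addrA; apply/eqP.
rewrite addrC -subr_eq vE; apply/eqP.
rewrite scaler_suml addrC -sumrB; apply: eq_bigr => i.
by rewrite !inE => /andP[/negPf-> _]; rewrite scalerBr scalerA.
Qed.

(** * Positive hulls and minimal generators of pointed cones *)

Section PositiveHull.
Variables (R : realType) (n d : nat) (W : 'I_n -> 'cV[R]_d).
Implicit Types (I J : {set 'I_n}) (v w : 'cV[R]_d).

Lemma pos0 I : pos W I 0.
Proof.
by exists (fun=> 0); split=> //; rewrite big1 // => i _; rewrite scale0r.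
Qed.

Lemma posD I v w : pos W I v -> pos W I w -> pos W I (v + w).
Proof.
move=> [c [c0 ->]] [e [e0 ->]]; exists (fun i => c i + e i).
split=> [i|]; first by rewrite addr_ge0.
by rewrite -big_split /=; apply: eq_bigr => i _; rewrite scalerDl.
Qed.

Lemma posZ I a v : 0 <= a -> pos W I v -> pos W I (a *: v).
Proof.
move=> a0 [c [c0 ->]]; exists (fun i => a * c i).
split=> [i|]; first by rewrite mulr_ge0.
by rewrite scaler_sumr; apply: eq_bigr => i _; rewrite scalerA.
Qed.

Lemma pos_mem I i : i \in I -> pos W I (W i).
Proof.
move=> iI; exists (fun j => (j == i)%:R); split=> [j|]; first exact: ler0n.
rewrite (big_setD1 i) //= eqxx scale1r big1 ?addr0 // => j.
by rewrite !inE => /andP[/negPf-> _]; rewrite scale0r.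
Qed.

Lemma pos_sum I (K : finType) (A : {set K}) (c : K -> R) (F : K -> 'cV[R]_d) :
  (forall i, i \in A -> 0 <= c i) -> (forall i, i \in A -> pos W I (F i)) ->
  pos W I (\sum_(i in A) c i *: F i).
Proof.
move=> c0 FI; elim/big_ind: _ => [|v w|i iA]; [exact: pos0|exact: posD|].
by apply: posZ; [exact: c0|exact: FI].
Qed.

Lemma sub_pos I J : (forall i, i \in I -> pos W J (W i)) -> pos W I `<=` pos W J.
Proof. by move=> IJ v [c [c0 ->]]; apply: pos_sum. Qed.

(* Farkas is applied after projecting orthogonally to [W i]. *)
Lemma separated_generator I i j :
  (forall w, pos W I w -> pos W I (- w) -> w = 0) ->
  (forall k, k \in I -> ~ pos W (I :\ k) (W k)) ->
  i \in I -> j \in I :\ i ->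
  exists a, [/\ dot a (W i) = 0, dot a (W j) < 0 &
                forall k, k \in I :\ i -> dot a (W k) <= 0].
Proof.
move=> pointed minimal iI jIi; have /finset.setD1P[ji jI] := jIi.
have W_neq0 k : k \in I -> W k != 0.
  by move=> kI; apply/eqP => Wk0; apply: (minimal _ kI); rewrite Wk0; exact: pos0.
have Wii := dot_gt0 (W_neq0 _ iI).
pose s w := dot w (W i) / dot (W i) (W i).
apply: contrapT => no_sep.
have [|c [c0 cE]] := @farkas _ _ _ (fun k => W k - s (W k) *: W i) (I :\ i)
    (- (W j - s (W j) *: W i)).
  move=> u uW; rewrite leNgt; apply/negP => ju; apply: no_sep.
  have proj w : dot (u - s u *: W i) w = dot (w - s w *: W i) u.
    by rewrite /s !dotBl !dotZl (dotC u w) (dotC u) (dotC w (W i)); ring.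
  exists (u - s u *: W i); split=> [||k kI]; rewrite proj.
  - by rewrite /s divff ?gt_eqF // scale1r subrr dotC dot0r.
  - by rewrite dotNl oppr_gt0 in ju.
  - exact: uW.
pose t := s (W j) + \sum_(k in I :\ i) c k * s (W k).
have tE : W j + \sum_(k in I :\ i) c k *: W k = t *: W i.
  have {}cE : \sum_(k in I :\ i) c k *: W k -
      \sum_(k in I :\ i) (c k * s (W k)) *: W i = s (W j) *: W i - W j.
    rewrite -[RHS]opprB cE -sumrB; apply: eq_bigr => k _.
    by rewrite scalerBr scalerA.
  by rewrite /t scalerDl scaler_suml -[X in W j + X](subrK
    (\sum_(k in I :\ i) (c k * s (W k)) *: W i)) cE addrA addrCA subrr addr0.
have sum_pos : pos W (I :\ i) (\sum_(k in I :\ i) c k *: W k).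
  by apply: pos_sum => // k; exact: pos_mem.
(* If [t <= 0], the identity [tE] puts [- W j] in the cone, against pointedness. If [t > 0], it
   writes [W i] through the other generators, against minimality. *)
have [t_le0|t_gt0] := lerP t 0.
  suff /(pointed _ (pos_mem jI)) Wj0 : pos W I (- W j).
    by move: (W_neq0 j jI); rewrite Wj0 eqxx.
  have -> : - W j = \sum_(k in I :\ i) c k *: W k + (- t) *: W i.
    by rewrite scaleNr -tE opprD addrCA subrr addr0.
  apply: posD; last by apply: posZ; [rewrite oppr_ge0|exact: pos_mem].
  apply: sub_pos sum_pos => k /finset.setD1P[_]; exact: pos_mem.
apply: (minimal _ iI); rewrite -(scalerK (lt0r_neq0 t_gt0) (W i)) -tE.
apply: posZ; first by rewrite invr_ge0 ltW.
by apply: posD sum_pos; exact: pos_mem.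
Qed.

(** Add up the functionals that separate the single generators [W j]: each vanishes at [W i], none
    is positive at another generator, and the [j]-th is negative at [W j]. *)
Lemma exposed_generator I i :
  (forall w, pos W I w -> pos W I (- w) -> w = 0) ->
  (forall k, k \in I -> ~ pos W (I :\ k) (W k)) -> i \in I ->
  exists a, dot a (W i) = 0 /\ forall j, j \in I :\ i -> dot a (W j) < 0.
Proof.
move=> pointed minimal iI.
have /choice[f fP] : forall j, exists a, j \in I :\ i ->
    [/\ dot a (W i) = 0, dot a (W j) < 0 &
        forall k, k \in I :\ i -> dot a (W k) <= 0].
  move=> j; have [jI|jI] := boolP (j \in I :\ i); last by exists 0.
  by have [a aP] := separated_generator pointed minimal iI jI; exists a.
exists (\sum_(j in I :\ i) f j); split=> [|j jI]; rewrite dot_suml.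
  by apply: big1 => j /fP[].
rewrite (big_setD1 j) //= ltr_wnDr //; last by have [] := fP _ jI.
by apply: sumr_le0 => k /finset.setD1P[_ /fP[_ _]]; apply.
Qed.

End PositiveHull.

(** * Cones of a pointed fan are generated by its rays *)

Lemma halflineP (R : realType) (d : nat) (v x : 'cV[R]_d) :
  halfline v x <-> exists2 c, 0 <= c & x = c *: v.
Proof.
have sumE (c : 'I_1 -> R) :
    \sum_(i in (finset.setT : {set 'I_1})) c i *: v = c 0 *: v.
  by under eq_bigl do rewrite inE; rewrite big_ord1.
split=> [[c [c0 ->]]|[c c0 ->]]; first by exists (c 0).
by exists (fun=> c); rewrite sumE.
Qed.

(** An inclusion-minimal generating subfamily works: the functional exposing one of its generators
    attains the value 0 on the cone only along that half-line. *)
Lemma pointed_cone_generated_by_rays (R : realType) (d : nat)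
    (C : set 'cV[R]_d) :
  polyhedral_cone C -> (forall w, C w -> C (- w) -> w = 0) ->
  exists (k : nat) (W : 'I_k -> 'cV[R]_d) (I : {set 'I_k}),
    C = pos W I /\
    forall i, i \in I -> W i != 0 /\ face C (halfline (W i)).
Proof.
move=> [k [W CE]] pointed; exists k, W.
have [I /minsetP[/asboolP IE Imin] _] :=
  @minset_exists _ (fun I => `[< C = pos W I >]) _ (asboolT CE).
exists I; split=> // i iI; rewrite {}IE {CE} in pointed Imin *.
have minimal j : j \in I -> ~ pos W (I :\ j) (W j).
  move=> jI Wj; suff IE : I :\ j = I by move: jI; rewrite -IE setD11.
  apply: Imin (finset.subD1set _ _); apply/asboolP.
  apply/seteqP; split; apply: sub_pos => l.
    by move=> lI; have [->//|lj] := eqVneq l j; apply: pos_mem; rewrite !inE lj.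
  by move=> /finset.setD1P[_]; exact: pos_mem.
split; first by apply/eqP => Wi0; apply: (minimal _ iI); rewrite Wi0; exact: pos0.
have [a [ai0 aI]] := exposed_generator pointed minimal iI.
have aE (c : 'I_k -> R) : dot a (\sum_(j in I) c j *: W j) =
    \sum_(j in I :\ i) c j * dot a (W j).
  rewrite dot_sumr (big_setD1 i) //= dotZr ai0 mulr0 add0r.
  by apply: eq_bigr => j _; rewrite dotZr.
have term_le0 c j : 0 <= c -> j \in I :\ i -> c * dot a (W j) <= 0.
  by move=> c0 /aI aj; rewrite mulr_ge0_le0 // ltW.
split; first by exists (W i); apply/halflineP; exists 1; rewrite ?scale1r.
exists a, 0; split=> [x [c [c0 ->]]|].
  by rewrite aE; apply: sumr_le0 => j /term_le0; apply.
apply/seteqP; split=> x.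
  move=> /halflineP[c c0 ->]; split; first by apply: posZ => //; exact: pos_mem.
  by rewrite /= dotZr ai0 mulr0.
move=> [[c [c0 ->]] /=]; rewrite aE => sum0; apply/halflineP; exists (c i) => //.
rewrite (big_setD1 i) //= big1 ?addr0 // => j jI.
have /eqP : \sum_(j in I :\ i) - (c j * dot a (W j)) = 0 by rewrite sumrN sum0 oppr0.
rewrite psumr_eq0 => [/allP/(_ j (mem_index_enum _))|l /term_le0 tl]; last first.
  by rewrite oppr_ge0 tl.
rewrite jI /= oppr_eq0 mulf_eq0 => /orP[/eqP->|]; first by rewrite scale0r.
by rewrite lt_eqF // aI.
Qed.

Lemma fan_cone_pointed (R : realType) (d : nat) (Delta : set (set 'cV[R]_d))
    (C : set 'cV[R]_d) (w : 'cV[R]_d) :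
  is_fan Delta -> pointed_fan Delta -> Delta C -> C w -> C (- w) -> w = 0.
Proof.
move=> [Dcone _ _] Dpointed DC Cw CNw.
have [k [W CE]] := Dcone _ DC.
suff /Dpointed : forall x, x \in <[w]>%VS -> C x.
  by move=> /(_ DC) w0; apply/eqP; rewrite -memv0 -w0 memv_line.
move=> x /vlineP[a ->]; rewrite CE in Cw CNw *.
have [a0|a0] := leP 0 a; first exact: posZ.
by rewrite -(opprK a) scaleNr -scalerN; apply: posZ; rewrite // oppr_ge0 ltW.
Qed.

(** The half-lines generating [C] are faces of [C], hence rays of the fan, hence spanned by rows of
    [V]. *)
Lemma fan_cone_generated (R : realType) (n d : nat) (V : 'M[R]_(n, d))
    (Delta : set (set 'cV[R]_d)) (C : set 'cV[R]_d) (v : 'cV[R]_d) :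
  is_fan Delta -> pointed_fan Delta ->
  rays Delta = [set halfline (cvec V i) | i in setT] ->
  Delta C -> C v ->
  exists (I : {set 'I_n}),
    (forall i, i \in I -> C (cvec V i)) /\ pos (cvec V) I v.
Proof.
move=> Dfan Dpointed Drays DC Cv; have [Dcone Dface _] := Dfan.
have [k [W [J [CE WJ]]]] := pointed_cone_generated_by_rays (Dcone _ DC)
  (fun w => fan_cone_pointed Dfan Dpointed DC).
pose I := [set i | `[< C (cvec V i) >]]%SET.
exists I; split=> [i|]; first by rewrite inE => /asboolP.
move: Cv; rewrite {1}CE => -[c [c0 ->]]; apply: pos_sum => // j /[dup] jJ.
move=> /WJ[Wj0 /(Dface _ _ DC) DWj].
have : rays Delta (halfline (W j)) by split=> //; exists (W j).
rewrite Drays => -[i _ iE].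
(* Equal half-lines make [W j] and [cvec V i] nonnegative multiples of each other, so [cvec V i]
   lies in [C] and generates [W j]. *)
have : halfline (cvec V i) (cvec V i).
  by apply/halflineP; exists 1; rewrite ?scale1r.
have : halfline (W j) (W j) by apply/halflineP; exists 1; rewrite ?scale1r.
rewrite -{1}iE => /halflineP[a a0 ->]; rewrite iE => /halflineP[b b0 Vi].
apply: posZ => //; apply: pos_mem; rewrite inE; apply/asboolP.
by rewrite Vi CE; apply: posZ => //; exact: pos_mem.
Qed.

(** * Tight inequalities and the normal fan of [polyhedron V h] *)

Lemma dot_cvec (R : realType) (n d : nat) (V : 'M[R]_(n, d)) i x :
  dot (cvec V i) x = (V *m x) i 0.
Proof. by rewrite mxE; apply: eq_bigr => k _; rewrite !mxE. Qed.

Definition active (R : realType) (n d : nat) (V : 'M[R]_(n, d)) (h : 'cV[R]_n)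
    (x : 'cV[R]_d) : {set 'I_n} :=
  [set i | (V *m x) i 0 == h i 0]%SET.

Section Polyhedron.
Variables (R : realType) (n d : nat) (V : 'M[R]_(n, d)).
Implicit Types (h : 'cV[R]_n) (x y p u : 'cV[R]_d) (J : {set 'I_n}).

(** Walk from [x] along [u] until the first inequality becomes tight. Only those with positive slope
    can, and [i0] guarantees that there is one. *)
Lemma ratio_test h x u i0 :
  polyhedron V h x -> 0 < (V *m u) i0 0 ->
  exists t i, [/\ 0 <= t, polyhedron V h (x + t *: u), 0 < (V *m u) i 0 &
                  i \in active V h (x + t *: u)].
Proof.
move=> Px ui0; pose r i := (h i 0 - (V *m x) i 0) / (V *m u) i 0.
have [i ui rmin] := @arg_minP _ _ _ i0 (fun i => 0 < (V *m u) i 0) r ui0.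
have coordE t j : (V *m (x + t *: u)) j 0 = (V *m x) j 0 + t * (V *m u) j 0.
  by rewrite mulmxDr -scalemxAr !mxE.
have r0 : 0 <= r i by rewrite divr_ge0 ?subr_ge0 // ltW.
exists (r i), i; split=> // [j|]; last first.
  by rewrite inE coordE /r divfK ?lt0r_neq0 // addrC subrK.
rewrite coordE; have [uj|uj] := leP ((V *m u) j 0) 0.
  by rewrite (le_trans _ (Px j)) // gerDl mulr_ge0_le0.
by have := rmin j uj; rewrite /r ler_pdivlMr // lerBrDl.
Qed.

Lemma midpoint_active h x y :
  polyhedron V h x -> polyhedron V h y ->
  polyhedron V h (2^-1 *: (x + y)) /\
  active V h (2^-1 *: (x + y)) = active V h x :&: active V h y.
Proof.
move=> Px Py.
have coordE j : (V *m (2^-1 *: (x + y))) j 0 =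
    2^-1 * ((V *m x) j 0 + (V *m y) j 0).
  by rewrite -scalemxAr mulmxDr !mxE.
split=> [j|].
  by rewrite coordE; have := Px j; have := Py j; lra.
apply/finset.setP => j; rewrite !inE coordE; have := Px j; have := Py j.
move: ((V *m x) j 0) ((V *m y) j 0) (h j 0) => a b c bc ac.
apply/eqP/andP => [E|[/eqP-> /eqP->]]; last by field.
by split; apply/eqP; lra.
Qed.

(** By Farkas' lemma it suffices that a direction increasing no tight inequality can be followed for
    a positive distance inside the polyhedron, since [u] cannot grow on the way. *)
Lemma maximizer_pos_active h x u :
  polyhedron V h x -> (forall p, polyhedron V h p -> dot u p <= dot u x) ->
  pos (cvec V) (active V h x) u.
Proof.
move=> Px xmax; apply: farkas => w wact.
suff [t t0 /xmax] : exists2 t, 0 < t & polyhedron V h (x + t *: w).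
  by rewrite dotDr dotZr gerDl pmulr_rle0.
have [[i0 wi0]|w_le0] := pselect (exists i, 0 < (V *m w) i 0); last first.
  exists 1; rewrite // scale1r => i; rewrite mulmxDr mxE.
  rewrite (le_trans _ (Px i)) // gerDl leNgt; apply/negP => wi.
  by apply: w_le0; exists i.
have [t [i [t0 Pt wi iact]]] := ratio_test Px wi0.
(* With [t = 0] the inequality [i] would already be tight at [x], where [w] has nonpositive
   slope. *)
exists t; rewrite // lt_neqAle t0 andbT; apply: contraTneq wi => tE.
by rewrite -leNgt -dot_cvec wact //; rewrite -tE scale0r addr0 in iact.
Qed.

Lemma dot_le_active h x p u :
  pos (cvec V) (active V h x) u -> polyhedron V h p -> dot u p <= dot u x.
Proof.
move=> [c [c0 ->]] Pp; rewrite !dot_suml; apply: ler_sum => i.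
by rewrite inE => /eqP xi; rewrite !dotZl !dot_cvec xi ler_wpM2l.
Qed.

(** Such an [x] acts as a relative interior point of [F]: whatever is a positive combination of the
    normals tight at [x] is one at every point of [F]. *)
Lemma normal_cone_active h (F : set 'cV[R]_d) x :
  F x -> (forall p, F p -> polyhedron V h p /\ active V h x \subset active V h p) ->
  normal_cone (polyhedron V h) F = pos (cvec V) (active V h x).
Proof.
move=> Fx Fact; apply/seteqP; split=> u.
  by move=> /(_ x Fx)[Px xmax]; exact: maximizer_pos_active.
move=> uact p /Fact[Pp xp]; split=> // q Pq; apply: (dot_le_active _ Pq).
by apply: sub_pos uact => i /(fintype.subsetP xp); exact: pos_mem.
Qed.

(** Normal cones are indexed by points instead of faces, which reduces comparing normal fans to
    comparing active sets. *)
Lemma normal_fan_active h :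
  normal_fan (polyhedron V h) =
  [set pos (cvec V) (active V h x) | x in polyhedron V h].
Proof.
apply/seteqP; split=> C.
  move=> [F [[x0 Fx0] [a [b [ab FE]]]] <-].
  (* A point of [F] with inclusion-minimal active set. Midpoints intersect active sets and stay in
     [F], so this minimal set is contained in all the others. *)
  have [|A /minsetP[/asboolP[x Fx xA] Amin] _] := @minset_exists _
      (fun A => `[< exists2 x, F x & active V h x = A >]) (active V h x0).
    by apply/asboolP; exists x0.
  have Px : polyhedron V h x by move: Fx; rewrite FE => -[].
  exists x => //; rewrite (normal_cone_active Fx) // => p Fp.
  have Pp : polyhedron V h p by move: Fp; rewrite FE => -[].
  split=> //; have [Pm mE] := midpoint_active Px Pp.
  suff Fm : F (2^-1 *: (x + p)).
    have <- : active V h (2^-1 *: (x + p)) = active V h x.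
      rewrite [RHS]xA; apply: Amin; last by rewrite mE -xA finset.subsetIl.
      by apply/asboolP; exists (2^-1 *: (x + p)).
    by rewrite mE finset.subsetIr.
  move: Fx Fp; rewrite FE => -[_ /= xb] [_ /= pb]; split=> //=.
  by rewrite dotZr dotDr xb pb; field.
(* The sum of the normals tight at [x] attains its maximum exactly at the points where all these
   inequalities are tight. *)
move=> [x Px <-]; pose v := \sum_(i in active V h x) cvec V i.
have vx : dot v x = \sum_(i in active V h x) h i 0.
  rewrite dot_suml; apply: eq_bigr => i.
  by rewrite inE dot_cvec => /eqP.
have vle p : polyhedron V h p -> dot v p <= dot v x.
  move=> Pp; rewrite vx dot_suml; apply: ler_sum => i _.
  by rewrite dot_cvec.
exists (polyhedron V h `&` [set p | dot v p = dot v x]); last first.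
  apply: normal_cone_active => // p [Pp /= vp]; split=> //.
  apply/fintype.subsetP => i ix; rewrite inE -subr_eq0 -oppr_eq0 opprB.
  have /eqP : \sum_(j in active V h x) (h j 0 - (V *m p) j 0) = 0.
    rewrite sumrB -vx -vp dot_suml -sumrB; apply: big1 => j _.
    by rewrite dot_cvec subrr.
  rewrite psumr_eq0 => [/allP/(_ i (mem_index_enum _))|j _].
    by rewrite ix.
  by rewrite subr_ge0.
by split; [exists x|exists v, (dot v x)].
Qed.

(* [z] is pushed away from [y] until a new inequality becomes tight, while
   the [k]-th one remains slack. *)
Lemma active_enlarge h y z k :
  positively_spanning V -> polyhedron V h y -> polyhedron V h z ->
  active V h z \subset active V h y -> k \in active V h y ->
  k \notin active V h z ->
  exists z', [/\ polyhedron V h z', active V h z \proper active V h z' &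
                 k \notin active V h z'].
Proof.
move=> Vspan Py Pz zy ky kz.
(* Otherwise [z - y], a nonnegative combination of the rows of [V], would have nonpositive inner
   product with itself. *)
have [i0 zi0] : exists i, 0 < (V *m (z - y)) i 0.
  apply: contrapT => /forallNP zle.
  have zyN0 : z - y != 0.
    by rewrite subr_eq0; apply: contraNneq kz => ->.
  have [c [c0 zyE]] : pos_all (cvec V) (z - y) by rewrite Vspan.
  have := dot_gt0 zyN0; rewrite {1}zyE dot_suml ltNge sumr_le0 // => i _.
  by rewrite dotZl dot_cvec mulr_ge0_le0 // leNgt; apply/negP/zle.
have [t [i [t0 Pt zi iact]]] := ratio_test Pz zi0.
have coordE j : (V *m (z + t *: (z - y))) j 0 =
    (V *m z) j 0 + t * ((V *m z) j 0 - (V *m y) j 0).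
  by rewrite mulmxDr -scalemxAr mulmxBr !mxE.
exists (z + t *: (z - y)); split=> //.
  rewrite fintype.properE; apply/andP; split; apply/fintype.subsetP.
    move=> j jz; have := fintype.subsetP zy j jz; move: jz; rewrite !inE coordE.
    by move=> /eqP-> /eqP->; rewrite subrr mulr0 addr0.
  move=> /(_ i iact) iz; have := fintype.subsetP zy i iz; move: iz zi; rewrite !inE.
  have -> : (V *m (z - y)) i 0 = (V *m z) i 0 - (V *m y) i 0.
    by rewrite mulmxBr !mxE.
  by move=> /eqP-> zi /eqP yi; rewrite yi subrr ltxx in zi.
move: ky kz; rewrite !inE coordE => /eqP->; have := Pz k.
rewrite le_eqVlt => /predU1P[->|lt_k _]; first by rewrite eqxx.
rewrite lt_eqF //; apply: (@le_lt_trans _ _ ((V *m z) k 0)) => //.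
by rewrite gerDl mulr_ge0_le0 // subr_le0 ltW.
Qed.

Lemma active_transfer h1 h2 x1 :
  positively_spanning V ->
  (forall J, (exists2 x, polyhedron V h1 x & J \subset active V h1 x) <->
             (exists2 x, polyhedron V h2 x & J \subset active V h2 x)) ->
  polyhedron V h1 x1 ->
  exists2 x2, polyhedron V h2 x2 & active V h2 x2 = active V h1 x1.
Proof.
move=> Vspan feas Px1; set J := active V h1 x1.
(* Choose [z] in the first polyhedron with maximal active set containing [J] but not [k]. If [k]
   were tight at the matching point of the second polyhedron, transferring back would give a [y]
   that lets [active_enlarge] contradict maximality. *)
have slack k : k \notin J ->
    exists x, [/\ polyhedron V h2 x, J \subset active V h2 x &
                  k \notin active V h2 x].
  move=> kJ; have [|A /maxsetP[/asboolP[z [Pz zA kz]] Amax] JA] :=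
      @maxset_exists _ (fun A => `[< exists z, [/\ polyhedron V h1 z,
        active V h1 z = A & k \notin active V h1 z] >]) J.
    by apply/asboolP; exists x1.
  have [|x Px zx] := (feas (active V h1 z)).1; first by exists z.
  exists x; split=> //; first by rewrite (fintype.subset_trans _ zx) // zA.
  apply/negP => kx; have [|y Py] := (feas (k |: active V h1 z)%SET).2.
    by exists x => //; rewrite finset.subUset finset.sub1set kx.
  rewrite finset.subUset finset.sub1set => /andP[ky zy].
  have [z' [Pz' zz' kz']] := active_enlarge Vspan Py Pz zy ky kz.
  have /Amax : `[< exists w, [/\ polyhedron V h1 w,
      active V h1 w = active V h1 z' & k \notin active V h1 w] >].
    by apply/asboolP; exists z'.
  rewrite -zA fintype.proper_sub // => /(_ isT) zE.
  by move: zz'; rewrite zE fintype.properxx.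
have [|x0 Px0 Jx0] := (feas J).1; first by exists x1.
(* Take a minimal active set containing [J]. An extra index [k] would be removed by the midpoint
   with the point from [slack]. *)
have [|A /minsetP[/asboolP[x [Px JA xA]] Amin] _] := @minset_exists _
    (fun A => `[< exists x, [/\ polyhedron V h2 x, J \subset A &
                               active V h2 x = A] >]) (active V h2 x0).
  by apply/asboolP; exists x0.
exists x => //; apply/eqP; rewrite finset.eqEsubset xA JA andbT.
apply/fintype.subsetP => k kA; apply: contraT => /slack[y [Py Jy ky]].
have [Pm mE] := midpoint_active Px Py.
have := Amin (active V h2 (2^-1 *: (x + y))).
rewrite mE -xA finset.subsetIl => /(_ _ isT) xyE.
move: kA ky; rewrite -xA -xyE; first by rewrite !inE => /andP[_ ->].
apply/asboolP; exists (2^-1 *: (x + y)).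
by split=> //; rewrite finset.subsetI xA JA Jy.
Qed.

End Polyhedron.

(** * Gale duality, support vectors and the chamber *)

(** A representation of [pi h] with coefficients [c] on [I] says that [h] minus the vector of these
    coefficients is some [V *m x]; thus the coefficients are the slacks of [x]. *)
Lemma pos_gale_dual (R : realType) (n d : nat) (V : 'M[R]_(n, d))
    (pi : {linear 'cV[R]_n -> 'cV[R]_(n - d)}) (h : 'cV[R]_n)
    (I : {set 'I_n}) :
  quotient_projection V pi ->
  pos (gale_dual pi) I (pi h) <->
  exists2 x, polyhedron V h x & ~: I \subset active V h x.
Proof.
move=> [_ kerE].
have sumE (c : 'I_n -> R) :
    \sum_(i in I) c i *: gale_dual pi i = pi (\sum_(i in I) c i *: delta_mx i 0).
  by rewrite linear_sum; apply: eq_bigr => i _; rewrite linearZ.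
have coordE (c : 'I_n -> R) j :
    (\sum_(i in I) c i *: (delta_mx i 0 : 'cV[R]_n)) j 0 =
    if j \in I then c j else 0.
  rewrite summxE; have [jI|/negbTE jI] := boolP (j \in I).
    rewrite (big_setD1 j) //= !mxE !eqxx mulr1 big1 ?addr0 // => i.
    by rewrite !inE !mxE eq_sym => /andP[/negPf-> _]; rewrite mulr0.
  rewrite big1 // => i iI; rewrite !mxE.
  by have [ji|_] := eqVneq j i; [rewrite ji iI in jI|rewrite mulr0].
have subE (u v : 'cV[R]_n) j : (u - v) j 0 = u j 0 - v j 0 by rewrite !mxE.
split=> [[c [c0]]|[x Px xI]].
  rewrite sumE => /eqP; rewrite -subr_eq0 -linearB => /eqP/kerE[x xE].
  exists x => [j|]; [|apply/fintype.subsetP => j; rewrite !inE => /negPf jI];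
    rewrite -xE subE coordE.
    by case: ifP => _; rewrite ?subr0 // gerBl.
  by rewrite jI subr0.
exists (fun i => h i 0 - (V *m x) i 0); split=> [i|]; first by rewrite subr_ge0.
rewrite sumE; apply/eqP; rewrite -subr_eq0 -linearB; apply/eqP/kerE; exists x.
apply/matrixP => j k; rewrite (ord1 k) subE coordE.
case: ifP => [_|/negbT jI]; first by rewrite opprB addrC subrK.
have : j \in active V h x by apply: (fintype.subsetP xI); rewrite inE.
by rewrite inE subr0 => /eqP.
Qed.

(** If [cvec V j] lies in the normal cone of [x], then [x] maximises it, and the maximum is [h j 0]
    because [h] is a support vector. The right-hand side depends on the normal fan alone. *)
Lemma feasible_normal_fan (R : realType) (n d : nat) (V : 'M[R]_(n, d))
    (h : 'cV[R]_n) (J : {set 'I_n}) :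
  support_vector V (polyhedron V h) h ->
  (exists2 x, polyhedron V h x & J \subset active V h x) <->
  (exists2 C, normal_fan (polyhedron V h) C &
              forall j, j \in J -> C (cvec V j)).
Proof.
rewrite normal_fan_active => hsupp; split=> [[x Px /fintype.subsetP Jx]|].
  by exists (pos (cvec V) (active V h x)) => [|j /Jx]; [exists x|exact: pos_mem].
move=> [_ [x Px <-] Jx]; exists x => //; apply/fintype.subsetP => j /Jx vj.
have [_ [p Pp pj]] := hsupp j.
by rewrite inE eq_le Px -pj -dot_cvec (dot_le_active vj).
Qed.

(* A point violating some inequality of [P] with normal [u] violates one whose
   normal is a ray of the cone of [Delta] containing [u], since the support
   function of [P] is linear on that cone. *)
Lemma polyhedron_of_normal_fan (R : realType) (n d : nat) (V : 'M[R]_(n, d))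
    (Delta : set (set 'cV[R]_d)) (P : set 'cV[R]_d) :
  is_fan Delta -> complete_fan Delta -> pointed_fan Delta ->
  rays Delta = [set halfline (cvec V i) | i in setT] ->
  has_normal_fan Delta P ->
  exists2 h, P = polyhedron V h & support_vector V P h.
Proof.
move=> Dfan Dcomplete Dpointed Drays [[m [A [b PE]]] NP].
(* By completeness [u] lies in the normal cone of some nonempty face, and any point of that face
   maximises all vectors of the cone at once. *)
have maxP u : exists C p, [/\ Delta C, C u, P p &
    forall v, C v -> forall x, P x -> dot v x <= dot v p].
  have [C DC Cu] : (\bigcup_(C in Delta) C) u by rewrite Dcomplete.
  have [F [[p Fp] _] FC] : normal_fan P C by rewrite NP.
  exists C, p; split=> //; first by move: Cu; rewrite -FC => /(_ p Fp)[].
  by move=> v; rewrite -FC => /(_ p Fp)[].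
have /choice[p pP] i : exists p, P p /\
    forall x, P x -> dot (cvec V i) x <= dot (cvec V i) p.
  by have [C [p [_ Cv Pp Cp]]] := maxP (cvec V i); exists p; split=> //; exact: Cp.
exists (\col_i dot (cvec V i) (p i)) => [|i]; last first.
  by have [Pp pmax] := pP i; rewrite mxE; split=> //; exists (p i).
apply/seteqP; split=> x.
  by move=> Px i; rewrite -dot_cvec mxE; have [_] := pP i; apply.
move=> Vx; rewrite PE => j; rewrite -dot_cvec.
have [C [q [DC Cu Pq Cq]]] := maxP (cvec A j).
have [I [IC [c [c0 uE]]]] := fan_cone_generated Dfan Dpointed Drays DC Cu.
apply: (@le_trans _ _ (dot (cvec A j) q)); last first.
  by move: Pq; rewrite PE dot_cvec.
rewrite uE !dot_suml; apply: ler_sum => i iI; rewrite !dotZl ler_wpM2l //.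
have := Vx i; rewrite -dot_cvec mxE => /le_trans; apply.
by apply: (Cq _ (IC i iI)); have [] := pP i.
Qed.

Lemma type_cone_chamber (R : realType) (n d : nat) (V : 'M[R]_(n, d))
    (pi : {linear 'cV[R]_n -> 'cV[R]_(n - d)})
    (Delta : set (set 'cV[R]_d)) (h0 : 'cV[R]_n) :
  positively_spanning V -> quotient_projection V pi ->
  has_normal_fan Delta (polyhedron V h0) ->
  support_vector V (polyhedron V h0) h0 ->
  type_cone V pi Delta = [set y | same_open_chamber (gale_dual pi) (pi h0) y].
Proof.
move=> Vspan pi_quotient [_ N0] h0supp; apply/seteqP; split=> y.
  move=> [h [[_ N] hsupp ->]] I; rewrite !(pos_gale_dual _ _ pi_quotient).
  by rewrite !feasible_normal_fan // N0 N.
have [/(_ y)[h <-] _] := pi_quotient => chamber.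
have feas (J : {set 'I_n}) :
    (exists2 x, polyhedron V h0 x & J \subset active V h0 x) <->
    (exists2 x, polyhedron V h x & J \subset active V h x).
  by rewrite -(finset.setCK J) -!(pos_gale_dual _ _ pi_quotient).
exists h; split=> //.
  split; first by exists n, V, h.
  rewrite -N0 !normal_fan_active; apply/seteqP; split=> _ [x Px <-].
    have feasC J := iff_sym (feas J).
    by have [x' Px' <-] := active_transfer Vspan feasC Px; exists x'.
  by have [x' Px' <-] := active_transfer Vspan feas Px; exists x'.
(* Since [h0] is a support vector, each single inequality can be made tight for [h0], hence also for
   [h]. *)
move=> i; split=> [x|]; first by rewrite dot_cvec.
have [_ [x0 Px0 x0i]] := h0supp i.
have [|x Px] := (feas [set i]%SET).1.
  by exists x0; rewrite // finset.sub1set inE -dot_cvec x0i.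
by rewrite finset.sub1set inE -dot_cvec => /eqP xi; exists x.
Qed.

(** A relatively open chamber contains its representative, so it is nonempty; [Delta_polytopal]
    provides a point of the type cone. *)
Theorem corollary1p42 (R : realType) (n d : nat) (V : 'M[R]_(n, d))
    (pi : {linear 'cV[R]_n -> 'cV[R]_(n - d)})
    (Delta : set (set 'cV[R]_d))
    (V_unit : forall i, enorm (cvec V i) = 1)
    (V_distinct : injective (cvec V))
    (V_spanning : positively_spanning V)
    (pi_quotient : quotient_projection V pi)
    (Delta_fan : is_fan Delta)
    (Delta_complete : complete_fan Delta)
    (Delta_pointed : pointed_fan Delta)
    (Delta_rays : rays Delta = [set halfline (cvec V i) | i in setT])
    (Delta_polytopal : exists P : set 'cV[R]_d, has_normal_fan Delta P) :
  rel_open_chamber (gale_dual pi) (type_cone V pi Delta) /\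
  chamber_fan (gale_dual pi) (closure (type_cone V pi Delta)).
Proof.
have [P PD] := Delta_polytopal.
have [h PE hsupp] := polyhedron_of_normal_fan Delta_fan Delta_complete
  Delta_pointed Delta_rays PD.
rewrite {}PE in PD hsupp.
have chamber : rel_open_chamber (gale_dual pi) (type_cone V pi Delta).
  by exists (pi h); exact: type_cone_chamber.
by split=> //; exists (type_cone V pi Delta).
Qed.
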